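(* Let $m,n,r$ be positive integers and let $\mathcal{P}=\mathrm{Pyr}^r(\mathcal{T}_m)\times [0,n]^n$, an integral polytope of dimension $n+r+3$. Then for all sufficiently large $m$ (with $n,r\ge 1$ fixed), the coefficient of $t^{j}$ in the Ehrhart polynomial $i(\mathcal{P},t)$ is negative for every $1\le j\le n+1$.
   Context: An integral polytope is a convex polytope all of whose vertices have integer coordinates. For an integral polytope $\mathcal{P}\subseteq\mathbb{R}^N$ of dimension $d$, $i(\mathcal{P},t)=|t\mathcal{P}\cap\mathbb{Z}^N|$ for positive integers $t$ is a polynomial in $t$ of degree $d$ (the Ehrhart polynomial). For a positive integer $m$, the Reeve tetrahedron $\mathcal{T}_m\subseteq\mathbb{R}^3$ is the convex hull of $(0,0,0),(1,0,0),(0,1,0),(1,1,m)$. For a polytope $\mathcal{P}\subseteq\mathbb{R}^N$ with vertices $v_1,\dots,v_s$, its pyramid is $\mathrm{Pyr}(\mathcal{P})=\mathrm{conv}\{(v_1,0),\dots,(v_s,0),(0,\dots,0,1)\}\subseteq\mathbb{R}^{N+1}$, and $\mathrm{Pyr}^k(\mathcal{P})$ for $k\ge2$ is defined recursively as $\mathrm{Pyr}(\mathrm{Pyr}^{k-1}(\mathcal{P}))$ (with $\mathrm{Pyr}^1=\mathrm{Pyr}$). $\times$ denotes the Cartesian product of polytopes, and $[0,n]^n\subseteq\mathbb{R}^n$ is the cube of side length $n$. *)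

(* Defs.v *)
From mathcomp Require Import all_boot all_order all_algebra.
From mathcomp Require Import boolp classical_sets functions cardinality reals convex.

Import Order.TTheory GRing.Theory Num.Theory.
Local Open Scope classical_set_scope.
Local Open Scope ring_scope.

(* [smallest C S] is the intersection of all sets in C containing S. *)
Definition conv {R : realType} {N : nat} (S : set 'rV[R]_N) : set 'rV[R]_N :=
  smallest (fun A : set 'rV[R]_N => convex_set A) S.

Definition polytope {R : realType} {N : nat} (P : set 'rV[R]_N) : Prop :=
  exists2 S : set 'rV[R]_N, finite_set S & P = conv S.

(* Vertices are the extreme points. *)
Definition vertices {R : realType} {N : nat} (P : set 'rV[R]_N) : set 'rV[R]_N :=
  [set v | P v /\
    forall (x y : 'rV[R]_N) (s : R), P x -> P y -> 0 < s < 1 ->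
      v = s *: x + (1 - s) *: y -> x = v /\ y = v].

Definition integer_points (R : realType) (N : nat) : set 'rV[R]_N :=
  [set x | forall i, x 0 i \is a Num.int].

Definition integral_polytope {R : realType} {N : nat} (P : set 'rV[R]_N) : Prop :=
  polytope P /\ vertices P `<=` integer_points R N.

(* The affine hull of P is x0 + (row space of V), where the row space of V is
   the smallest linear subspace containing P - x0; its rank is dim P. *)
Definition has_dim {R : realType} {N : nat} (P : set 'rV[R]_N) (d : nat) : Prop :=
  exists2 x0, P x0 & exists V : 'M[R]_N,
    [/\ forall x, P x -> (x - x0 <= V)%MS,
        forall W : 'M[R]_N, (forall x, P x -> (x - x0 <= W)%MS) -> (V <= W)%MS
      & \rank V = d].

(* The condition determines p, since it fixes its values at all t > 0. *)
Definition is_ehrhart_poly {R : realType} {N : nat} (P : set 'rV[R]_N)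
    (p : {poly rat}) : Prop :=
  forall t : nat, (0 < t)%N ->
    exists2 k : nat,
      (([set t%:R *: x | x in P] `&` integer_points R N) #= `I_k)%card &
      p.[t%:R] = k%:R.

Definition row3 {R : realType} (a b c : R) : 'rV[R]_3 := \row_(i < 3) [:: a; b; c]`_i.

Definition reeve (R : realType) (m : nat) : set 'rV[R]_3 :=
  conv [set row3 0 0 0; row3 1 0 0; row3 0 1 0; row3 1 1 m%:R].

Definition pyr {R : realType} {N : nat} (P : set 'rV[R]_N) : set 'rV[R]_(N + 1) :=
  conv ([set row_mx v 0 | v in vertices P] `|` [set row_mx 0 (const_mx 1)]).

(* Each step adds one coordinate; the ambient dimension is N + k, written as an
   iteration so that no casts are needed. *)
Fixpoint iter_pyr {R : realType} (k : nat) {N : nat} (P : set 'rV[R]_N) :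
    set 'rV[R]_(iter k (addn^~ 1%N) N) :=
  match k return set 'rV[R]_(iter k (addn^~ 1%N) N) with
  | 0 => P
  | k'.+1 => pyr (iter_pyr k' P)
  end.

Definition cart_prod {R : realType} {N1 N2 : nat}
    (P : set 'rV[R]_N1) (Q : set 'rV[R]_N2) :
    set 'rV[R]_(N1 + N2) :=
  [set row_mx x y | x in P & y in Q].

Definition cube (R : realType) (n : nat) : set 'rV[R]_n :=
  [set x | forall i, 0 <= x 0 i <= n%:R].

Definition pyr_reeve_cube (R : realType) (m n r : nat) :
    set 'rV[R]_(iter r (addn^~ 1%N) 3%N + n) :=
  cart_prod (iter_pyr r (reeve R m)) (cube R n).

(* Main.v *)
(* The iterated pyramid over the Reeve tetrahedron has Ehrhart polynomial
   C(t+r+3, r+3) + (m-1) C(t+r+1, r+3): for r = 0 this comes from the half-open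
   fundamental box of the cone over the tetrahedron, whose nonzero lattice points
   all have height 2, and each pyramid step sums the counts of the smaller
   dilates, so the hockey-stick identity applies. As m grows, the signs are those
   of the factor of m-1, namely, up to a positive scalar, X (X - 1) Q with
   Q = (X+1)...(X+r+1) (nX+1)^n. Its coefficients of index 1, ..., n+1 are negative
   as soon as those of Q strictly increase up to index n. The binomial coefficients
   of (nX+1)^n are nondecreasing, with equality only in the last step; the factor
   X+1 makes the increase strict and the factors X+a, a >= 1, preserve it. *)
From mathcomp Require Import all_boot all_order all_algebra.
From mathcomp Require Import finmap boolp classical_sets functions cardinality.
From mathcomp Require Import interval_inference reals convex.
From mathcomp Require Import lra ring zify.
(* Last, so that [conv] is the convex hull and not the operation of convex.v. *)
Require Import Defs.
Import Order.TTheory GRing.Theory Num.Theory.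
Local Open Scope ring_scope.

Lemma const_mx0 (V : nmodType) p q : const_mx 0 = 0 :> 'M[V]_(p, q).
Proof. by apply/matrixP=> i j; rewrite !mxE. Qed.

(** * Convex hulls, their vertices, products and pyramids *)

Section Convexity.
Local Open Scope classical_set_scope.
Context {R : realType}.
Implicit Type N : nat.

Lemma convex_setP N (A : set 'rV[R]_N) :
  convex_set A <-> forall (x y : 'rV[R]_N) (s : R), A x -> A y -> 0 <= s <= 1 ->
    A (s *: x + (1 - s) *: y).
Proof.
split=> [cA x y s Ax Ay /andP[s0 s1]|cA x y s].
  have := cA x y (Itv01 s0 s1); rewrite !inE; exact.
rewrite !inE => Ax Ay; apply: (cA x y s%:num) => //.
by apply/andP; split.
Qed.

Lemma conv_convex N (S : set 'rV[R]_N) : convex_set (conv S).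
Proof.
apply/convex_setP => x y s Sx Sy s01 A [cA SA].
by move/convex_setP: (cA); apply => //; [exact: Sx|exact: Sy].
Qed.

Lemma conv_comb N (S : set 'rV[R]_N) (x y : 'rV[R]_N) (s : R) :
  conv S x -> conv S y -> 0 <= s <= 1 -> conv S (s *: x + (1 - s) *: y).
Proof. by move: x y s; apply/convex_setP/conv_convex. Qed.

Lemma sub_conv N (S : set 'rV[R]_N) : S `<=` conv S.
Proof. exact: sub_gen_smallest. Qed.

Lemma conv_min N (S A : set 'rV[R]_N) : S `<=` A ->
  (forall (x y : 'rV[R]_N) (s : R), A x -> A y -> 0 <= s <= 1 ->
    A (s *: x + (1 - s) *: y)) -> conv S `<=` A.
Proof. by move=> SA cA; apply: smallest_sub => //; exact/convex_setP. Qed.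

(* Removing an extreme point from a convex set leaves a convex set. *)
Lemma vertices_conv_sub N (S : set 'rV[R]_N) : vertices (conv S) `<=` S.
Proof.
move=> v [Sv vext]; apply: contrapT => nSv.
suff /(_ _ Sv)[_] : conv S `<=` conv S `\ v by apply.
apply: conv_min => [x Sx|x y s [Sx xv] [Sy yv] s01].
  by split; [exact: sub_conv|move=> xv; apply: nSv; rewrite -xv].
split; first exact: conv_comb.
move=> e; case/andP: (s01); rewrite le_eqVlt => /orP[/eqP s0 _|s0].
  by apply: yv; rewrite -e -s0 scale0r add0r subr0 scale1r.
rewrite le_eqVlt => /orP[/eqP s1|s1].
  by apply: xv; rewrite -e s1 subrr scale0r addr0 scale1r.
have [] := vext x y s Sx Sy _ (esym e); first by rewrite s0 s1.
by move=> /xv.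
Qed.

(** Key to every extremality proof below: a nonnegative affine quantity that vanishes inside a
    segment vanishes at both ends. *)
Lemma conv_comb_eq0 (s u w : R) : 0 < s < 1 -> 0 <= u -> 0 <= w ->
  s * u + (1 - s) * w = 0 -> u = 0 /\ w = 0.
Proof.
move=> /andP[s0 s1] u0 w0 /eqP; have s1' : 0 < 1 - s by rewrite subr_gt0.
rewrite paddr_eq0 ?pmulr_rge0// !mulf_eq0 (gt_eqF s0) (gt_eqF s1')/=.
by move=> /andP[/eqP-> /eqP->].
Qed.

(** Induction on [k]: the first point is split off and the other weights are rescaled by
    [1 - w ord0]; if that is zero, they all vanish. *)
Lemma conv_sum N (S : set 'rV[R]_N) k (w : 'I_k -> R) (v : 'I_k -> 'rV[R]_N) :
  (forall i, 0 <= w i) -> \sum_i w i = 1 -> (forall i, conv S (v i)) ->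
  conv S (\sum_i w i *: v i).
Proof.
elim: k w v => [|k IH] w v w0 w1 Sv.
  by move: w1; rewrite big_ord0 => /eqP; rewrite eq_sym oner_eq0.
move: w1; rewrite !big_ord_recl => w1.
have s0 : 0 <= \sum_(i < k) w (lift ord0 i) by apply: sumr_ge0.
have [e|ne] := eqVneq (\sum_(i < k) w (lift ord0 i)) 0.
  rewrite big1 => [|i _]; last first.
    by move/eqP: e; rewrite psumr_eq0// => /allP/(_ i (mem_index_enum _))/eqP->; rewrite scale0r.
  by move: w1; rewrite e !addr0 => ->; rewrite scale1r.
have e : 1 - w ord0 = \sum_(i < k) w (lift ord0 i) by rewrite -w1 addrAC subrr add0r.
have -> : \sum_(i < k) w (lift ord0 i) *: v (lift ord0 i) = (1 - w ord0) *:
    \sum_(i < k) (w (lift ord0 i) / (1 - w ord0)) *: v (lift ord0 i).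
  rewrite scaler_sumr; apply: eq_bigr => i _.
  by rewrite scalerA mulrCA e divff ?mulr1.
apply: conv_comb => //; last by rewrite w0; lra.
apply: IH => [i||//]; first by rewrite divr_ge0// e.
by rewrite -mulr_suml e divff.
Qed.

(** The hard inclusion fills in one factor at a time: first [y] ranges over [conv T] with a
    generator [x'] fixed, then [x] over [conv S] with [y] fixed. *)
Lemma conv_prod N1 N2 (S : set 'rV[R]_N1) (T : set 'rV[R]_N2) :
  cart_prod (conv S) (conv T) = conv (cart_prod S T).
Proof.
apply/seteqP; split; last first.
  apply: conv_min => [_ [x Sx [y Sy <-]]|_ _ s [x Sx [y Sy <-]] [x' Sx' [y' Sy' <-]] s01].
    by exists x; [exact: sub_conv|exists y; [exact: sub_conv|]].
  exists (s *: x + (1 - s) *: x'); first exact: conv_comb.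
  exists (s *: y + (1 - s) *: y'); first exact: conv_comb.
  by rewrite !scale_row_mx add_row_mx.
move=> _ [x Sx [y Ty <-]].
have H x' : S x' -> conv T `<=` [set y | conv (cart_prod S T) (row_mx x' y)].
  move=> Sx'; apply: conv_min => [y' Ty'|y1 y2 s /= h1 h2 s01].
    by apply: sub_conv; exists x' => //; exists y'.
  have -> : row_mx x' (s *: y1 + (1 - s) *: y2) =
      s *: row_mx x' y1 + (1 - s) *: row_mx x' y2.
    by rewrite !scale_row_mx add_row_mx -scalerDl [_ + (1 - _)]addrC subrK scale1r.
  exact: conv_comb.
suff : conv S `<=` [set x | conv (cart_prod S T) (row_mx x y)] by apply.
apply: conv_min => [x' Sx'|x1 x2 s /= h1 h2 s01]; first exact: H.
have -> : row_mx (s *: x1 + (1 - s) *: x2) y =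
    s *: row_mx x1 y + (1 - s) *: row_mx x2 y.
  by rewrite !scale_row_mx add_row_mx -scalerDl [_ + (1 - _)]addrC subrK scale1r.
exact: conv_comb.
Qed.

(** The pyramid is the union of the segments from the base to the apex, with [s] the height. Since
    [pyr] is built from the vertices alone, the base has to be recovered as their hull. *)
Lemma pyrE N (P : set 'rV[R]_N) : conv (vertices P) = P -> P !=set0 ->
  pyr P = [set row_mx ((1 - s) *: x) (const_mx s) | s in [set s : R | 0 <= s <= 1] & x in P].
Proof.
move=> PE [p0 Pp0].
have cP x y s : P x -> P y -> 0 <= s <= 1 -> P (s *: x + (1 - s) *: y).
  by rewrite -PE; exact: conv_comb.
apply/seteqP; split.
  apply: conv_min => [_ [[v [Pv _] <-]|/= ->]|].
  - exists 0; first by rewrite /= lexx ler01.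
    by exists v => //; rewrite subr0 scale1r const_mx0.
  - exists 1; first by rewrite /= lexx ler01.
    by exists p0 => //; rewrite subrr scale0r.
  move=> _ _ l [s /andP[s0 s1] [x Px <-]] [s' /andP[s'0 s'1] [x' Px' <-]] /andP[l0 l1].
  pose u := l * s + (1 - l) * s'.
  have uE : 1 - u = l * (1 - s) + (1 - l) * (1 - s') by rewrite /u; ring.
  have a0 : 0 <= l * (1 - s) by rewrite mulr_ge0 ?subr_ge0.
  have b0 : 0 <= (1 - l) * (1 - s') by rewrite mulr_ge0 ?subr_ge0.
  have c0 : 0 <= l * s by rewrite mulr_ge0.
  have d0 : 0 <= (1 - l) * s' by rewrite mulr_ge0 ?subr_ge0.
  have cE : l *: const_mx s + (1 - l) *: const_mx s' = const_mx u :> 'rV_1.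
    by apply/rowP => i; rewrite !mxE.
  have u01 : 0 <= u <= 1 by apply/andP; split; [exact: addr_ge0|rewrite -subr_ge0 uE addr_ge0].
  clearbody u; exists u => //.
  (* At height 1 the combination is the apex, and any base point serves as witness. Otherwise the
     base point is the combination of [x] and [x'] with weights renormalized by [1 - u]. *)
  have [e|ne] := eqVneq (1 - u) 0.
    exists p0 => //; rewrite e scale0r !scale_row_mx add_row_mx cE !scalerA.
    move/eqP: e; rewrite uE paddr_eq0// => /andP[/eqP-> /eqP->].
    by rewrite !scale0r addr0.
  exists ((l * (1 - s) / (1 - u)) *: x + (1 - l * (1 - s) / (1 - u)) *: x').
    have u0 : 0 < 1 - u by rewrite lt_neqAle eq_sym ne uE addr_ge0.
    apply: cP => //; rewrite divr_ge0 ?(ltW u0)//= ler_pdivrMr// mul1r uE; lra.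
  rewrite !scale_row_mx add_row_mx cE scalerDr !scalerA; congr (row_mx (_ *: _ + _ *: _) _).
    by field.
  by rewrite mulrBr mulr1 [_ * (_ / _)]mulrC divfK// uE; ring.
have H : P `<=` [set x | pyr P (row_mx x 0)].
  rewrite -{1}PE; apply: conv_min => [v Pv|x y s /= px py s01].
    by apply: sub_conv; left; exists v.
  have -> : row_mx (s *: x + (1 - s) *: y) 0 =
      s *: row_mx x 0 + (1 - s) *: row_mx y 0 :> 'rV[R]_(N + 1).
    by rewrite !scale_row_mx add_row_mx !scaler0 addr0.
  exact: conv_comb.
move=> _ [s /andP[s0 s1] [x Px <-]].
have -> : row_mx ((1 - s) *: x) (const_mx s) =
    (1 - s) *: row_mx x 0 + (1 - (1 - s)) *: row_mx 0 (const_mx 1) :> 'rV[R]_(N + 1).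
  rewrite !scale_row_mx add_row_mx !scaler0 addr0 add0r; congr row_mx.
  by apply/rowP => i; rewrite !mxE; lra.
apply: conv_comb; [exact: H| |lra].
by apply: sub_conv; right.
Qed.

(** The heights decide: a segment through a base vertex has both ends at height 0, where extremality
    in [P] applies; one through the apex has both ends at height 1, where the apex is the only
    point. *)
Lemma vertices_pyr N (P : set 'rV[R]_N) : conv (vertices P) = P -> P !=set0 ->
  vertices (pyr P) = [set row_mx v 0 | v in vertices P] `|` [set row_mx 0 (const_mx 1)].
Proof.
move=> PE P0; apply/seteqP; split; first exact: vertices_conv_sub.
have pyrS v : ([set row_mx v 0 | v in vertices P] `|` [set row_mx 0 (const_mx 1)]) v ->
  pyr P v by exact: sub_conv.
move=> w Hw; split; first exact: pyrS.
move: Hw; rewrite (pyrE _ P PE P0).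
move=> + _ _ l [s /andP[s0 s1] [x Px <-]] [s' /andP[s'0 s'1] [x' Px' <-]] l01.
rewrite !scale_row_mx add_row_mx => -[[v Pv <-]|->] /eq_row_mx[].
  move=> vE /rowP/(_ 0); rewrite !mxE => /esym/(conv_comb_eq0 _ _ _ l01 s0 s'0)[s_0 s'_0].
  move: vE; rewrite s_0 s'_0 !subr0 !scale1r const_mx0 => vE.
  by have [_ /(_ _ _ _ Px Px' l01 vE)[-> ->]] := Pv.
move=> _ /rowP/(_ 0); rewrite !mxE => e.
have [] := conv_comb_eq0 l (1 - s) (1 - s') l01; rewrite ?subr_ge0//.
  by move: e; lra.
move=> e1 e2; rewrite e1 e2 !scale0r.
have -> : s = 1 by lra.
by have -> : s' = 1 by lra.
Qed.

End Convexity.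

(** * The Reeve tetrahedron by inequalities, and its vertices *)

Section Reeve.
Local Open Scope classical_set_scope.
Context {R : realType}.
Implicit Types (x y : 'rV[R]_3) (m t : nat).

Lemma row3_eta x : x = row3 (x 0 0) (x 0 1) (x 0 2).
Proof.
apply/rowP => -[[|[|[|//]]] i]; rewrite mxE /=; congr (x _ _); exact: val_inj.
Qed.

Lemma row3_inj (a b c a' b' c' : R) :
  row3 a b c = row3 a' b' c' -> [/\ a = a', b = b' & c = c'].
Proof.
by move=> /rowP e; move: (e 0) (e 1) (e 2); rewrite !mxE.
Qed.

Lemma row3D (s u a b c a' b' c' : R) : s *: row3 a b c + u *: row3 a' b' c' =
  row3 (s * a + u * a') (s * b + u * b') (s * c + u * c').
Proof.
rewrite [LHS]row3_eta; congr row3; by rewrite !mxE.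
Qed.

Lemma row3Z (s a b c : R) : s *: row3 a b c = row3 (s * a) (s * b) (s * c).
Proof. by rewrite [LHS]row3_eta; congr row3; rewrite !mxE. Qed.

Definition reeve_corners m : set 'rV[R]_3 :=
  [set row3 0 0 0; row3 1 0 0; row3 0 1 0; row3 1 1 m%:R].

(* The four inequalities say that the barycentric coordinates are nonnegative,
   up to the positive factor m. *)
Definition reeve_ineq m (t a b c : R) : Prop :=
  [/\ 0 <= c, c <= m%:R * a, c <= m%:R * b & m%:R * (a + b) - c <= m%:R * t].

Lemma reeve_ineqP m (a b c : R) : (0 < m)%N ->
  reeve R m (row3 a b c) <-> reeve_ineq m 1 a b c.
Proof.
move=> m0; have m_gt0 : 0 < m%:R :> R by rewrite ltr0n.
split.
  suff : reeve R m `<=` [set x | reeve_ineq m 1 (x 0 0) (x 0 1) (x 0 2)].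
    by move=> /[apply]; rewrite /= !mxE.
  apply: conv_min => [x Sx|x y s /= [x1 x2 x3 x4] [y1 y2 y3 y4] /andP[s0 s1]].
    by case: Sx => [[[]|]|] -> /=; rewrite !mxE /=; split; lra.
  have s1' : 0 <= 1 - s by lra.
  rewrite !mxE; split; nra.
move=> [h1 h2 h3 h4].
(* Barycentric coordinates: the third coordinate forces the weight [c / m] of the last corner, and
   the others follow. *)
pose w := [:: 1 - (a + b) + c / m%:R; a - c / m%:R; b - c / m%:R; c / m%:R].
pose v : seq 'rV[R]_3 := [:: row3 0 0 0; row3 1 0 0; row3 0 1 0; row3 1 1 m%:R].
have -> : row3 a b c = \sum_(i < 4) w`_i *: v`_i.
  rewrite [RHS]row3_eta !big_ord_recl big_ord0 !mxE /=.
  by congr row3; field; rewrite gt_eqF.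
have mM : c / m%:R * m%:R = c by rewrite divfK// gt_eqF.
apply: conv_sum => [[[|[|[|[|//]]]] i]||[[|[|[|[|//]]]] i]] /=.
- nra.
- nra.
- nra.
- nra.
- by rewrite !big_ord_recl big_ord0 /=; ring.
- by apply: sub_conv; do 3 left.
- by apply: sub_conv; do 2 left; right.
- by apply: sub_conv; left; right.
- by apply: sub_conv; right.
Qed.

Lemma reeve_neq0 m : reeve R m !=set0.
Proof. by exists (row3 0 0 0); apply: sub_conv; do 3 left. Qed.

(** The case [t = 0] is included because the counts for pyramids also involve the zeroth dilate of
    the base. *)
Lemma reeve_scaleP m t (a b c : R) : (0 < m)%N ->
  [set t%:R *: x | x in reeve R m] (row3 a b c) <-> reeve_ineq m t%:R a b c.
Proof.
move=> m0; have m_gt0 : 0 < m%:R :> R by rewrite ltr0n.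
case: t => [|t]; split.
- move=> [x _]; rewrite scale0r => /esym; rewrite [0]row3_eta !mxE.
  by move=> /row3_inj[-> -> ->]; split; lra.
(* For [t = 0] the inequalities give [2 c <= m (a + b) <= c], so only the origin is left. *)
- move=> [h1 h2 h3 h4]; have c0 : c = 0 by lra.
  move: h2 h3 h4; rewrite c0 !pmulr_rge0// => a0 b0 h4.
  have ab : a + b <= 0 by move: h4; rewrite subr0 mulr0 pmulr_rle0.
  have [x Px] := reeve_neq0 m; exists x => //.
  rewrite scale0r [LHS]row3_eta !mxE; congr row3; lra.
- have t0 : 0 < t.+1%:R :> R by rewrite ltr0n.
  move=> [x Px]; move: Px; rewrite [x]row3_eta row3Z.
  move=> /(reeve_ineqP _ _ _ _ m0)[h1 h2 h3 h4] /row3_inj[<- <- <-].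
  split; nra.
have t0 : 0 < t.+1%:R :> R by rewrite ltr0n.
move=> [h1 h2 h3 h4].
have e : row3 a b c = t.+1%:R *: row3 (t.+1%:R^-1 * a) (t.+1%:R^-1 * b) (t.+1%:R^-1 * c).
  by rewrite row3Z !mulVKf ?gt_eqF.
rewrite e; eexists; last by [].
apply/reeve_ineqP => //; split.
- by rewrite mulr_ge0// invr_ge0 ltW.
- by rewrite mulrCA ler_pM2l// invr_gt0.
- by rewrite mulrCA ler_pM2l// invr_gt0.
by rewrite -mulrDr mulrCA -mulrBr ler_pdivrMl// mulr1 [leRHS]mulrC.
Qed.

(** At each corner three of the four inequalities are tight. Tightness passes to both ends of a
    segment through the corner, and three tight inequalities determine a point. *)
Lemma vertices_reeve m : (0 < m)%N -> vertices (reeve R m) = reeve_corners m.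
Proof.
move=> m0; have m_gt0 : 0 < m%:R :> R by rewrite ltr0n.
apply/seteqP; split; first exact: vertices_conv_sub.
move=> v Sv; split; first exact: sub_conv.
move=> x y s; rewrite (row3_eta x) (row3_eta y).
move: (x 0 0) (x 0 1) (x 0 2) (y 0 0) (y 0 1) (y 0 2) => a b c a' b' c'.
move=> /(reeve_ineqP _ _ _ _ m0)[x1 x2 x3 x4] /(reeve_ineqP _ _ _ _ m0)[y1 y2 y3 y4] s01.
rewrite row3D => e.
have key (l l' : R) : 0 <= l -> 0 <= l' -> s * l + (1 - s) * l' = 0 -> l = 0 /\ l' = 0.
  exact: conv_comb_eq0.
have k1 := key _ _ x1 y1.
have k2 := key (m%:R * a - c) (m%:R * a' - c').
have k3 := key (m%:R * b - c) (m%:R * b' - c').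
have k4 := key (m%:R - (m%:R * (a + b) - c)) (m%:R - (m%:R * (a' + b') - c')).
rewrite mulr1 in x4 y4; rewrite !subr_ge0 in k2 k3 k4.
move: {k2}(k2 x2 y2) {k3}(k3 x3 y3) {k4}(k4 x4 y4) => k2 k3 k4.
have mI (u w : R) : m%:R * u = m%:R * w -> u = w by move=> /mulfI; apply; rewrite gt_eqF.
(* The factor [m] is kept on both sides so that the products are atoms for linear arithmetic. *)
have main (u1 u2 u3 : R) : v = row3 u1 u2 u3 ->
  [/\ c = u3, m%:R * a = m%:R * u1 & m%:R * b = m%:R * u2] /\
  [/\ c' = u3, m%:R * a' = m%:R * u1 & m%:R * b' = m%:R * u2] ->
  row3 a b c = v /\ row3 a' b' c' = v.
  by move=> -> [[-> /mI-> /mI->] [-> /mI-> /mI->]].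
case: Sv => [[[]|]|] /= vE; apply: (main _ _ _ vE); move: e; rewrite vE => /row3_inj[e1 e2 e3].
- have [] := k1; first lra.
  have [] := k2; first by nra.
  have [] := k3; first by nra.
  by do ?split; lra.
- have [] := k1; first lra.
  have [] := k4; first by nra.
  have [] := k3; first by nra.
  by do ?split; lra.
- have [] := k1; first lra.
  have [] := k2; first by nra.
  have [] := k4; first by nra.
  by do ?split; lra.
- have [] := k4; first by nra.
  have [] := k2; first by nra.
  have [] := k3; first by nra.
  by do ?split; lra.
Qed.

End Reeve.

(** * Integrality of the polytope *)

Section Integrality.
Local Open Scope classical_set_scope.
Context {R : realType}.

(** The invariant carried through the iterated pyramids: the first two fields make the vertices of
    the next pyramid computable, the last two yield an integral polytope. *)
Record lattice_hull {N : nat} (P : set 'rV[R]_N) : Prop := LatticeHull {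
  hull_vertices : conv (vertices P) = P;
  hull_neq0 : P !=set0;
  hull_finite : finite_set (vertices P);
  hull_int : vertices P `<=` integer_points R N }.

Lemma lattice_hull_reeve m : (0 < m)%N -> lattice_hull (reeve R m).
Proof.
move=> m0; split; rewrite ?vertices_reeve//; first exact: reeve_neq0.
  by rewrite /reeve_corners !finite_setU; do !split; exact: finite_set1.
by move=> x [[[]|]|] -> [[|[|[|//]]] i]; rewrite !mxE /= ?rpred0 ?rpred1 ?rpred_nat.
Qed.

Lemma lattice_hull_pyr N (P : set 'rV[R]_N) : lattice_hull P -> lattice_hull (pyr P).
Proof.
move=> [PE P0 Pfin Pint]; split; rewrite ?vertices_pyr//.
- have [v Pv] := P0; exists (row_mx 0 (const_mx 1)); apply: sub_conv; by right.
- by rewrite finite_setU; split; [exact: finite_image|exact: finite_set1].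
move=> _ [[v Pv <-]|->] i; rewrite mxE; case: (fintype.split i) => j;
  rewrite ?mxE ?rpred0 ?rpred1//.
exact: Pint.
Qed.

Lemma lattice_hull_iter_pyr m r : (0 < m)%N -> lattice_hull (iter_pyr r (reeve R m)).
Proof.
move=> m0; elim: r => [|r IH] /=; first exact: lattice_hull_reeve.
exact: lattice_hull_pyr.
Qed.

Definition cube_corners n : set 'rV[R]_n :=
  [set \row_i (if f i then n%:R else 0) | f in [set: {ffun 'I_n -> bool}]].

(** Coordinates are pushed to the ends of their range one by one: in [H], those of index at least
    [k] are already 0 or [n], and the induction step writes the point as a combination of its two
    modifications at index [k]. *)
Lemma cubeE n : cube R n = conv (cube_corners n).
Proof.
apply/seteqP; split; last first.
  apply: conv_min => [_ [f _ <-] i|x y s cx cy /andP[s0 s1] i].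
    by rewrite mxE; case: ifP; rewrite lexx ler0n.
  move: (cx i) (cy i); rewrite !mxE; move: (x 0 i) (y 0 i) => a b ha hb.
  by apply/andP; split; nra.
have H k x : cube R n x -> (forall i : 'I_n, (k <= i)%N -> x 0 i = 0 \/ x 0 i = n%:R) ->
    conv (cube_corners n) x.
  elim: k x => [|k IH] x cx hx.
    apply: sub_conv; exists [ffun i => x 0 i == n%:R] => //.
    apply/rowP => i; rewrite mxE ffunE; case: eqP => // xn.
    by have [->|] := hx i isT.
  have [kn|nk] := ltnP k n; last first.
    by apply: IH => // i ki; have := ltn_ord i; lia.
  have n0 : 0 < n%:R :> R by rewrite ltr0n; lia.
  pose j := Ordinal kn; pose u a : 'rV[R]_n := \row_i (if i == j then a else x 0 i).
  have -> : x = (x 0 j / n%:R) *: u n%:R + (1 - x 0 j / n%:R) *: u 0.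
    apply/rowP => i; rewrite !mxE; case: eqP => [->|_]; last by ring.
    by rewrite mulr0 addr0 divfK// gt_eqF.
  apply: conv_comb; last first.
  - by have /andP[x0 x1] := cx j; rewrite divr_ge0// ler_pdivrMr ?mul1r.
  - apply: IH => [i|i ki]; rewrite mxE; case: eqP => [_|ij //].
    + by rewrite lexx ler0n.
    + by left.
    apply: hx; rewrite ltn_neqAle ki andbT; apply/eqP => e; apply: ij; exact: val_inj.
  - apply: IH => [i|i ki]; rewrite mxE; case: eqP => [_|ij //].
    + by rewrite lexx ler0n.
    + by right.
    apply: hx; rewrite ltn_neqAle ki andbT; apply/eqP => e; apply: ij; exact: val_inj.
by move=> x cx; apply: (H n) => // i; rewrite leqNgt ltn_ord.
Qed.

Lemma integral_pyr_reeve_cube m n r : (0 < m)%N ->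
  integral_polytope (pyr_reeve_cube R m n r).
Proof.
move=> /(lattice_hull_iter_pyr _ r)[PE _ Pfin Pint].
rewrite /pyr_reeve_cube cubeE -PE conv_prod; split.
  eexists; last by [].
  by apply: finite_image2 => //; apply: finite_image; exact: finite_finset.
(* The vertices of a hull lie among its generators, here pairs of integer points. *)
move=> w /vertices_conv_sub[v Pv [_ [f _ <-] <-]] i.
rewrite mxE; case: (fintype.split i) => j; first exact: Pint.
by rewrite mxE; case: ifP; rewrite ?rpred0 ?rpred_nat.
Qed.

End Integrality.

(** * The dimension of the polytope *)

Section Dimension.
Local Open Scope classical_set_scope.
Context {R : realType}.

(** Full dimension in dual form: the set contains the origin and no nonzero linear form vanishes on
    it. A form on a product or a pyramid splits into blocks that can be tested separately. *)
Definition spanning {N : nat} (P : set 'rV[R]_N) : Prop :=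
  P 0 /\ forall c : 'cV[R]_N, (forall x, P x -> x *m c = 0) -> c = 0.

(** The columns of [cokermx W] are linear forms vanishing on the row space of [W], hence on [P]; so
    they are zero and [W] has full row space. *)
Lemma spanning_has_dim N (P : set 'rV[R]_N) : spanning P -> has_dim P N.
Proof.
move=> [P0 Psp]; exists 0 => //; exists 1%:M; split.
- by move=> x _; exact: submx1.
- move=> W hW; rewrite submxE mul1mx; apply/eqP/matrixP => i j.
  suff : col j (cokermx W) = 0 by move=> /matrixP/(_ i 0); rewrite !mxE.
  apply: Psp => x /hW; rewrite subr0 submxE => /eqP e.
  by rewrite colE mulmxA e mul0mx.
exact: mxrank1.
Qed.

Lemma row3_mul (a b c : R) (v : 'cV[R]_3) :
  (row3 a b c *m v) 0 0 = a * v 0 0 + b * v 1 0 + c * v 2 0.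
Proof.
rewrite !mxE !big_ord_recl big_ord0 !mxE /= addr0 addrA.
by congr (_ + _ * v _ _ + _ * v _ _); exact: val_inj.
Qed.

Lemma spanning_reeve m : (0 < m)%N -> spanning (reeve R m).
Proof.
move=> m0; have e0 : 0 = row3 0 0 0 :> 'rV[R]_3 by rewrite [0]row3_eta !mxE.
split; first by rewrite e0; apply: sub_conv; do 3 left.
move=> c hc.
have /hc/matrixP/(_ 0 0) : reeve R m (row3 1 0 0) by apply: sub_conv; do 2 left; right.
have /hc/matrixP/(_ 0 0) : reeve R m (row3 0 1 0) by apply: sub_conv; left; right.
have /hc/matrixP/(_ 0 0) : reeve R m (row3 1 1 m%:R) by apply: sub_conv; right.
rewrite !row3_mul ![(0 : 'M_(_, _)) _ _]mxE => h3 h2 h1.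
have c0 : c 0 0 = 0 by lra.
have c1 : c 1 0 = 0 by lra.
have : m%:R * c 2 0 = 0 by lra.
move=> /eqP; rewrite mulf_eq0 pnatr_eq0 eqn0Ngt m0 /= => /eqP c2.
apply/colP => -[[|[|[|//]]] i]; rewrite mxE.
- by rewrite -c0; congr (c _ _); exact: val_inj.
- by rewrite -c1; congr (c _ _); exact: val_inj.
- by rewrite -c2; congr (c _ _); exact: val_inj.
Qed.

Lemma spanning_pyr N (P : set 'rV[R]_N) : lattice_hull P -> spanning P -> spanning (pyr P).
Proof.
move=> [PE Pne _ _] [P0 Psp]; rewrite (pyrE _ P)//.
have H x : P x -> [set row_mx ((1 - s) *: x0) (const_mx s : 'rV_1)
    | s in [set s : R | 0 <= s <= 1] & x0 in P] (row_mx x 0).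
  move=> Px; exists 0; first by rewrite /= lexx ler01.
  by exists x => //; rewrite subr0 scale1r const_mx0.
split; first by rewrite -row_mx0; exact: H.
move=> c hc; rewrite -[c]vsubmxK in hc *.
have -> : usubmx c = 0.
  by apply: Psp => x /H/hc; rewrite mul_row_col mul0mx addr0.
suff -> : dsubmx c = 0 by rewrite col_mx0.
have /hc : [set row_mx ((1 - s) *: x0) (const_mx s : 'rV_1)
    | s in [set s : R | 0 <= s <= 1] & x0 in P] (row_mx 0 (const_mx 1)).
  exists 1; first by rewrite /= lexx ler01.
  by exists 0 => //; rewrite subrr scale0r.
rewrite mul_row_col mul0mx add0r => /matrixP/(_ 0 0).
rewrite mxE big_ord_recl big_ord0 addr0 mxE mul1r [RHS]mxE => e.
by apply/matrixP => i j; rewrite !ord1 e mxE.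
Qed.

Lemma spanning_cart_prod N1 N2 (P : set 'rV[R]_N1) (Q : set 'rV[R]_N2) :
  spanning P -> spanning Q -> spanning (cart_prod P Q).
Proof.
move=> [P0 Psp] [Q0 Qsp]; split; first by rewrite -row_mx0; exists 0 => //; exists 0.
move=> c hc; rewrite -[c]vsubmxK in hc *.
have -> : usubmx c = 0.
  apply: Psp => x Px; have := hc (row_mx x 0); rewrite mul_row_col mul0mx addr0.
  by apply; exists x => //; exists 0.
suff -> : dsubmx c = 0 by rewrite col_mx0.
apply: Qsp => x Px; have := hc (row_mx 0 x); rewrite mul_row_col mul0mx add0r.
by apply; exists 0 => //; exists x.
Qed.

Lemma spanning_cube n : spanning (cube R n).
Proof.
split; first by move=> i; rewrite mxE lexx ler0n.
move=> c hc; apply/colP => i; rewrite mxE.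
have /hc : cube R n (delta_mx 0 i).
  move=> j; rewrite mxE eqxx /=; case: eqP => [_|_]; last by rewrite lexx ler0n.
  (* The existence of the index [i] gives [1 <= n], so the unit vector lies in the cube. *)
  by rewrite ler01 ler1n; case: (n) i => [[]|].
by rewrite -rowE => /matrixP/(_ 0 0); rewrite !mxE.
Qed.

Lemma has_dim_pyr_reeve_cube m n r : (0 < m)%N ->
  has_dim (pyr_reeve_cube R m n r) (n + r + 3).
Proof.
move=> m0.
have -> : (n + r + 3 = iter r (addn^~ 1%N) 3 + n)%N.
  suff -> : (iter r (addn^~ 1) 3 = r + 3)%N by lia.
  by elim: r => //= r ->; lia.
apply: spanning_has_dim; apply: spanning_cart_prod; last exact: spanning_cube.
elim: r => [|r IH] /=; first exact: spanning_reeve.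
by apply: spanning_pyr => //; exact: lattice_hull_iter_pyr.
Qed.

End Dimension.

(** * Counting in finite sets *)

Section Cardinality.
Local Open Scope classical_set_scope.
Local Open Scope card_scope.

Lemma card_fset_setP (T : choiceType) (A : set T) : finite_set A ->
  A #= `I_(#|` fset_set A|)%fset.
Proof. by move=> fA; rewrite -{1}(fset_setK fA); exact/card_eq_fsetP. Qed.

Lemma card_setU_disjoint (T : choiceType) (A B : set T) (a b : nat) :
  A #= `I_a -> B #= `I_b -> A `&` B = set0 -> A `|` B #= `I_(a + b).
Proof.
move=> Aa Bb AB.
have fA : finite_set A by exists a.
have fB : finite_set B by exists b.
have fU : finite_set (A `|` B) by rewrite finite_setU.
have := card_fset_setP _ _ fU; rewrite fset_setU// cardfsU -fset_setI// AB.
by rewrite fset_set0 cardfs0 subn0 (card_fset_set Aa) (card_fset_set Bb).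
Qed.

Lemma card_bigcup (T : choiceType) (F : nat -> set T) (c : nat -> nat) (K : nat) :
  (forall i, (i < K)%N -> F i #= `I_(c i)) ->
  (forall i j x, (i < K)%N -> (j < K)%N -> F i x -> F j x -> i = j) ->
  \bigcup_(i in `I_K) F i #= `I_(\sum_(i < K) c i).
Proof.
elim: K => [|K IH] cF dF; first by rewrite II0 bigcup_set0 big_ord0 II0 card_eq00.
rewrite bigcup_mkord big_ord_recr /= big_ord_recr /= -bigcup_mkord.
apply: card_setU_disjoint; first by apply: IH => [i iK|i j x iK jK]; [apply: cF|apply: dF]; lia.
  exact: cF.
apply/seteqP; split=> // x [[i /= iK Fix] FKx].
by have := dF i K x (ltnW iK) (ltnSn K) Fix FKx; lia.
Qed.

Lemma card_finpred (T : finType) (P : pred T) : [set` P] #= `I_#|P|.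
Proof.
have -> : [set` P] = [set` [fset x in P]%fset].
  by apply/seteqP; split=> x /=; rewrite !inE.
by apply/card_eq_fsetP; exact: card_finset.
Qed.

Lemma card_inj_image (T U : Type) (f : T -> U) (A : set T) (a : nat) :
  {in A &, injective f} -> A #= `I_a -> f @` A #= `I_a.
Proof. by move=> /inj_card_eq fA Aa; rewrite (card_eql fA). Qed.

Lemma card_cart_prod (R : realType) N1 N2 (A : set 'rV[R]_N1) (B : set 'rV[R]_N2) a b :
  A #= `I_a -> B #= `I_b -> cart_prod A B #= `I_(a * b).
Proof.
move=> Aa Bb.
have fA : finite_set A by exists a.
have sX : size (fset_set A) = a by exact: card_fset_set.
have AX x : (x \in fset_set A) = (x \in A) by rewrite in_fset_set.
pose f i := nth 0 (fset_set A) i.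
(* With [A] enumerated by [f], the product is a disjoint union of [a] copies of [B]. *)
have -> : cart_prod A B = \bigcup_(i in `I_a) [set row_mx (f i) y | y in B].
  apply/seteqP; split=> [_ [x Ax [y By <-]]|_ [i Ii [y By <-]]].
    have xX : x \in fset_set A by rewrite AX inE.
    exists (index x (fset_set A)); first by rewrite /= -sX index_mem.
    by exists y => //; rewrite /f nth_index.
  exists (f i); last by exists y.
  by apply/set_mem; rewrite -AX mem_nth ?sX.
rewrite -[X in (X * _)%N]card_ord -sum_nat_const.
apply: card_bigcup => [i ia|i j _ ia ja [y _ <-] [y' _ /eq_row_mx[e _]]].
  by apply: card_inj_image => // y y' _ _ /eq_row_mx[].
by apply/eqP; rewrite -(nth_uniq 0 _ _ (fset_uniq (fset_set A))) ?sX//; exact/eqP.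
Qed.

Definition triples (k : nat) : set (nat * nat * nat) :=
  [set p | (p.1.1 + p.1.2 + p.2 <= k)%N].

Lemma card_triples k : triples k #= `I_'C(k + 3, 3).
Proof.
rewrite addnC -card_partial_ord_partitions cardsE.
pose f (t : 3.-tuple 'I_k.+1) : nat * nat * nat := (val (tnth t 0), val (tnth t 1), val (tnth t 2)).
have finj : injective f.
  move=> t u [/val_inj e0 /val_inj e1 /val_inj e2]; apply: eq_from_tnth.
  move=> -[[|[|[|//]]] i].
  - by rewrite (_ : Ordinal i = 0)//; exact: val_inj.
  - by rewrite (_ : Ordinal i = 1)//; exact: val_inj.
  - by rewrite (_ : Ordinal i = 2)//; exact: val_inj.
have sumE (t : 3.-tuple 'I_k.+1) :
    (\sum_(i <- t) i = tnth t 0%R + tnth t 1%R + tnth t 2%R)%N.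
  rewrite big_tuple !big_ord_recl big_ord0 addn0 addnA.
  by congr (_ + tnth t _ + tnth t _)%N; exact: val_inj.
rewrite (_ : triples k = f @` [set` [pred t : 3.-tuple 'I_k.+1 | (\sum_(i <- t) i <= k)%N]]).
  by apply: card_inj_image (card_finpred _ _) => ? ? _ _; exact: finj.
apply/seteqP; split; last by move=> _ [t + <-]; rewrite /= inE sumE.
move=> [[x y] z]; rewrite /triples /= => h.
exists [tuple inord x; inord y; inord z] => /=.
  by rewrite inE sumE !(tnth_nth ord0) /= !inordK//; lia.
by rewrite /f !(tnth_nth ord0) /= !inordK//; lia.
Qed.

End Cardinality.

(** * Lattice points in dilates of cubes, products, pyramids and the tetrahedron *)

Section LatticePoints.
Local Open Scope classical_set_scope.
Context {R : realType}.

Definition dilate_points {N : nat} (P : set 'rV[R]_N) (t : nat) : set 'rV[R]_N :=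
  [set t%:R *: x | x in P] `&` integer_points R N.

(** Unlike [is_ehrhart_poly], this includes [t = 0], since the count for a pyramid sums over all
    smaller dilates of its base. *)
Definition ehrhart_count {N : nat} (P : set 'rV[R]_N) (L : nat -> nat) : Prop :=
  forall t, (dilate_points P t #= `I_(L t))%card.

Lemma int_ge0P (x : R) : x \is a Num.int -> 0 <= x -> exists k : nat, x = k%:R.
Proof. by move=> xZ x0; apply/natrP; rewrite natrEint xZ. Qed.

Lemma ehrhart_count_cube n : ehrhart_count (cube R n) (fun t => (t * n).+1 ^ n)%N.
Proof.
move=> t; pose f (g : {ffun 'I_n -> 'I_(t * n).+1}) : 'rV[R]_n := \row_i (g i)%:R.
have -> : dilate_points (cube R n) t = f @` [set` xpredT].
  apply/seteqP; split=> [_ [[x cx <-] xZ]|_ [g _ <-]].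
    have /choice[g gE] : forall i, exists k : nat, (t%:R *: x) 0 i = k%:R /\ (k < (t * n).+1)%N.
      move=> i; have /andP[x0 x1] := cx i.
      have [|k kE] := int_ge0P _ (xZ i); first by rewrite mxE mulr_ge0.
      exists k; split=> //; rewrite ltnS -(ler_nat R) -kE mxE natrM.
      exact: ler_wpM2l.
    exists [ffun i => inord (g i)] => //.
    by apply/rowP => i; have [-> gi] := gE i; rewrite mxE ffunE inordK.
  split; last by move=> i; rewrite mxE rpred_nat.
  have [t0|t0] := posnP t.
    exists 0 => [i|]; first by rewrite mxE lexx ler0n.
    rewrite scaler0; apply/rowP => i; rewrite !mxE.
    by have := ltn_ord (g i); rewrite [in X in (_ < X)%N]t0 mul0n ltnS leqn0 => /eqP ->.
  have t_gt0 : 0 < t%:R :> R by rewrite ltr0n.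
  exists (t%:R^-1 *: f g); last by rewrite scalerA divff ?scale1r ?gt_eqF.
  move=> i; rewrite !mxE mulr_ge0 ?invr_ge0 ?ler0n//= ler_pdivrMl// -natrM ler_nat.
  by have := ltn_ord (g i); lia.
rewrite -[X in `I_X](_ : #|{ffun 'I_n -> 'I_(t * n).+1}| = _); last first.
  by rewrite card_ffun !card_ord.
apply: card_inj_image; last exact: card_finpred.
move=> g h _ _ /rowP e; apply/ffunP => i; apply: val_inj.
by have := e i; rewrite !mxE => /eqP; rewrite eqr_nat => /eqP.
Qed.

Lemma ehrhart_count_cart_prod N1 N2 (P : set 'rV[R]_N1) (Q : set 'rV[R]_N2) L1 L2 :
  ehrhart_count P L1 -> ehrhart_count Q L2 ->
  ehrhart_count (cart_prod P Q) (fun t => L1 t * L2 t)%N.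
Proof.
move=> PL QL t.
have -> : dilate_points (cart_prod P Q) t = cart_prod (dilate_points P t) (dilate_points Q t).
  apply/seteqP; split=> [_ [[_ [x Px [y Qy <-]] <-] xyZ]|].
    rewrite scale_row_mx in xyZ *; exists (t%:R *: x).
      by split; [exists x|move=> i; have := xyZ (lshift _ i); rewrite row_mxEl].
    exists (t%:R *: y) => //.
    by split; [exists y|move=> i; have := xyZ (rshift _ i); rewrite row_mxEr].
  move=> _ [_ [[x Px <-] xZ] [_ [[y Qy <-] yZ] <-]]; split.
    by exists (row_mx x y); [exists x => //; exists y|rewrite scale_row_mx].
  by move=> i; rewrite mxE; case: (fintype.split i) => j; [exact: xZ|exact: yZ].
exact: card_cart_prod.
Qed.

(** Slicing by the integer height [k]: the slice of the dilated pyramid is the [(t - k)]-th dilate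
    of the base. *)
Lemma dilate_points_pyr N (P : set 'rV[R]_N) t : conv (vertices P) = P -> P !=set0 ->
  dilate_points (pyr P) t =
  \bigcup_(k in `I_t.+1) [set row_mx y (const_mx k%:R) | y in dilate_points P (t - k)].
Proof.
move=> PE P0; rewrite /dilate_points pyrE//; apply/seteqP; split.
  move=> _ [[_ [s /andP[s0 s1] [x Px <-]] <-]].
  rewrite scale_row_mx => xyZ.
  have := xyZ (rshift _ 0); rewrite row_mxEr !mxE => sZ.
  have [|k kE] := int_ge0P _ sZ; first by rewrite mulr_ge0.
  have kt : (k <= t)%N by rewrite -(ler_nat R) -kE ler_piMr.
  exists k; first by rewrite /= ltnS.
  exists ((t - k)%:R *: x); last first.
    rewrite natrB// -kE scalerA mulrBr mulr1; congr row_mx.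
    by apply/rowP => i; rewrite !mxE.
  split; first by exists x.
  move=> i; have := xyZ (lshift _ i); rewrite row_mxEl natrB// -kE scalerA.
  by rewrite mulrBr mulr1.
move=> _ [k /= kt [_ [[x Px <-] xZ] <-]]; split; last first.
  by move=> i; rewrite mxE; case: (fintype.split i) => j; [exact: xZ|rewrite mxE rpred_nat].
have {}kt : (k <= t)%N by lia.
(* The height before dilation is [k / t]; for [t = 0] the quotient is 0 by convention, consistent
   with [k <= t]. *)
exists (row_mx ((1 - k%:R / t%:R) *: x) (const_mx (k%:R / t%:R))).
  exists (k%:R / t%:R); last by exists x.
  rewrite /= divr_ge0//=; case: t kt {xZ} => [|t] kt; first by rewrite invr0 mulr0 ler01.
  by rewrite ler_pdivrMr ?ltr0n// mul1r ler_nat.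
have e : t%:R * (k%:R / t%:R) = k%:R :> R.
  case: t kt {xZ} => [|t] kt; last by rewrite mulrCA divff ?mulr1// pnatr_eq0.
  by rewrite mul0r; move: kt; rewrite leqn0 => /eqP->.
rewrite scale_row_mx scalerA mulrBr mulr1 e natrB//; congr row_mx.
by apply/rowP => i; rewrite !mxE.
Qed.

Lemma ehrhart_count_pyr N (P : set 'rV[R]_N) L : conv (vertices P) = P -> P !=set0 ->
  ehrhart_count P L -> ehrhart_count (pyr P) (fun t => \sum_(k < t.+1) L (t - k))%N.
Proof.
move=> PE P0 PL t; rewrite dilate_points_pyr//.
apply: (@card_bigcup _ _ (fun k => L (t - k)%N)) => [k _|].
  by apply: card_inj_image (PL _) => y y' _ _ /eq_row_mx[].
move=> i j _ _ _ [y _ <-] [y' _ /eq_row_mx[_ /rowP/(_ 0)]].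
by rewrite !mxE => /eqP; rewrite eqr_nat eq_sym => /eqP.
Qed.

(** Uniqueness of Euclidean division, which recovers the box point and the multiplicity of the last
    vertex from the third coordinate. *)
Lemma nat_lex_inj m q q' c c' : (c < m)%N -> (c' < m)%N ->
  (q * m + c = q' * m + c')%N -> q = q' /\ c = c'.
Proof.
move=> cm cm' e; have := congr1 (divn^~ m) e; have := congr1 (modn^~ m) e.
rewrite /= !modnMDl !divnMDl ?(leq_ltn_trans _ cm)// !modn_small// !divn_small//.
by rewrite !addn0.
Qed.

(** The inequalities of the tetrahedron divided by [m]: with third coordinate [c = q m + rho], the
    bounds [c / m] round up to [q + (0 < rho)] from below and down to [q] from above. *)
Lemma reeve_box m t q rho a b : (rho < m)%N ->
  (q * m + rho <= m * a)%N -> (q * m + rho <= m * b)%N ->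
  (m * (a + b) <= m * t + (q * m + rho))%N ->
  [/\ q + (0 < rho)%N <= a, q + (0 < rho)%N <= b & a + b <= t + q]%N.
Proof.
move=> rm ha hb hab; split.
- by case: rho rm ha {hb hab} => [|rho] rm ha /=; nia.
- by case: rho rm hb {ha hab} => [|rho] rm hb /=; nia.
nia.
Qed.

(* A point of the cone over the tetrahedron is a nonnegative integer combination
   of the vertices plus a point of the half-open fundamental box; the m box
   points are indexed by rho, and all of them but the origin have height 2. *)
Definition reeve_point (m rho : nat) (p : nat * nat * nat) : 'rV[R]_3 :=
  let e := (0 < rho)%N in
  row3 (p.1.2 + p.1.1 + e)%:R (p.2 + p.1.1 + e)%:R (p.1.1 * m + rho)%:R.

Lemma dilate_points_reeve m t : (0 < m)%N -> dilate_points (reeve R m) t =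
  \bigcup_(rho in `I_m) [set reeve_point m rho p |
    p in [set p | (p.1.1 + p.1.2 + p.2 + (0 < rho)%N.*2 <= t)%N]].
Proof.
move=> m0; have m_gt0 : 0 < m%:R :> R by rewrite ltr0n.
rewrite /dilate_points; apply/seteqP; split.
  move=> x [Px xZ]; move: Px; rewrite (row3_eta x).
  move=> /(reeve_scaleP _ _ _ _ _ m0)[h1 h2 h3 h4].
  have [c cE] := int_ge0P _ (xZ 2) h1.
  have [|a aE] := int_ge0P _ (xZ 0); first by rewrite -(pmulr_rge0 _ m_gt0); lra.
  have [|b bE] := int_ge0P _ (xZ 1); first by rewrite -(pmulr_rge0 _ m_gt0); lra.
  move: h2 h3 h4; rewrite aE bE cE lerBlDr -natrD -!natrM -natrD !ler_nat => h2 h3 h4.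
  have cdiv := divn_eq c m; have cmod := ltn_pmod c m0.
  set q := (c %/ m)%N in cdiv; set rho := (c %% m)%N in cdiv cmod.
  rewrite cdiv in h2 h3 h4.
  have [aq bq abq] := reeve_box _ _ _ _ _ _ cmod h2 h3 h4.
  (* Removing [q] copies of [(1, 1, m)] and the box point, which is [(1, 1, rho)] if [rho > 0],
     leaves the multiplicities of the two unit vectors. *)
  exists rho => //; exists (q, a - q - (0 < rho)%N, b - q - (0 < rho)%N)%N.
    by rewrite /= -muln2; lia.
  by rewrite /reeve_point /= -cdiv; congr row3; congr _%:R; lia.
move=> _ [rho /= rm [[[q a] b] /= h <-]]; split; last first.
  by move=> [[|[|[|//]]] i]; rewrite mxE /= rpred_nat.
apply/reeve_scaleP => //; rewrite /=; split; first exact: ler0n.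
- by rewrite -natrM ler_nat; case: rho rm {h} => [|rho] /= rm; nia.
- by rewrite -natrM ler_nat; case: rho rm {h} => [|rho] /= rm; nia.
rewrite lerBlDr -natrD -!natrM -natrD ler_nat; nia.
Qed.

Lemma ehrhart_count_reeve m : (0 < m)%N ->
  ehrhart_count (reeve R m) (fun t => 'C(t + 3, 3) + m.-1 * 'C(t + 1, 3))%N.
Proof.
move=> m0 t; rewrite dilate_points_reeve//.
have -> : ('C(t + 3, 3) + m.-1 * 'C(t + 1, 3) =
    \sum_(rho < m) if (0 < rho)%N then 'C(t + 1, 3) else 'C(t + 3, 3))%N.
  by case: m m0 => // m _; rewrite big_ord_recl /= sum_nat_const card_ord.
apply: (@card_bigcup _ _ (fun rho => if (0 < rho)%N then 'C(t + 1, 3) else 'C(t + 3, 3))).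
  move=> rho rm; apply: card_inj_image => [[[q a] b] [[q' a'] b'] _ _|].
    move=> /row3_inj[] /= /eqP; rewrite eqr_nat => /eqP e1 /eqP; rewrite eqr_nat => /eqP e2.
    move=> /eqP; rewrite eqr_nat => /eqP /(nat_lex_inj _ _ _ _ _ rm rm)[e _].
    by congr (_, _, _); lia.
  have [_|_] := posnP rho.
    by under eq_set do rewrite addn0; exact: card_triples.
  have [t2|t2] := leqP 2 t.
    have -> : (t + 1 = t - 2 + 3)%N by lia.
    rewrite (_ : [set _ | _] = triples (t - 2)); first exact: card_triples.
    by apply/seteqP; split=> -[[q a] b]; rewrite /triples /=; lia.
  (* For [t < 2] a box point of height 2 does not fit, and the binomial coefficient vanishes as
     well. *)
  rewrite bin_small; last by lia.
  rewrite (_ : [set _ | _] = set0) ?II0 ?card_eq00//.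
  by apply/seteqP; split=> -[[q a] b] //=; lia.
move=> i j x im jm [[[q a] b] _ <-] [[[q' a'] b'] _ /row3_inj[_ _ /eqP]] /=.
rewrite eqr_nat => /eqP e.
by have [] := nat_lex_inj _ _ _ _ _ im jm (esym e).
Qed.

Lemma ehrhart_count_ext N (P : set 'rV[R]_N) L L' : L =1 L' ->
  ehrhart_count P L -> ehrhart_count P L'.
Proof. by move=> e PL t; rewrite -e. Qed.

(** After reversal of the sum, induction on [t] by Pascal's rule; [d <= k] makes the boundary term
    ['C(d, k.+1)] vanish. *)
Lemma hockey_stick d k t : (d <= k)%N ->
  (\sum_(i < t.+1) 'C(t - i + d, k) = 'C(t + d.+1, k.+1))%N.
Proof.
move=> dk; rewrite (reindex_inj rev_ord_inj) /=.
rewrite (eq_bigr (fun i : 'I_t.+1 => 'C(i + d, k))) => [|i _]; last first.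
  by rewrite subSS subKn// -ltnS.
elim: t => [|t IH].
  by rewrite big_ord_recl big_ord0 addn0 !add0n binS (@bin_small d k.+1).
by rewrite big_ord_recr /= IH addSn addSn addnS [RHS]binS.
Qed.

End LatticePoints.

Lemma ehrhart_count_iter_pyr (R : realType) m r : (0 < m)%N ->
  ehrhart_count (iter_pyr r (reeve R m))
    (fun t => 'C(t + r.+3, r.+3) + m.-1 * 'C(t + r.+1, r.+3))%N.
Proof.
move=> m0; elim: r => [|r IH] /=; first exact: ehrhart_count_reeve.
have [PE P0 _ _] := lattice_hull_iter_pyr (R := R) _ r m0.
apply: ehrhart_count_ext (ehrhart_count_pyr _ _ _ PE P0 IH) => t.
by rewrite big_split -big_distrr /= !hockey_stick//; lia.
Qed.

(** * Signs of the coefficients *)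

Section Coefficients.

(** The positive constant coefficient counts as an increase from a zero coefficient of index -1. *)
Definition increasing_coefs (n : nat) (p : {poly rat}) : Prop :=
  0 < p`_0 /\ forall k, (k < n)%N -> p`_k < p`_k.+1.

(** Each increment of the product is an increment of [p] plus [a] times the next one. *)
Lemma increasing_coefs_mul n (p : {poly rat}) (a : rat) : 1 <= a ->
  increasing_coefs n p -> increasing_coefs n (('X + a%:P) * p).
Proof.
move=> a1 [p0 pI]; split.
  by rewrite mulrDl coefD coefXM coefCM /= add0r mulr_gt0//; lra.
move=> k kn; rewrite mulrDl !coefD !coefXM !coefCM /=.
have := pI _ kn; case: k kn => [|k] kn h /=; first by nra.
have := pI k (ltnW kn); nra.
Qed.

(** The Ehrhart polynomial of the cube. *)
Definition cube_poly (n : nat) : {poly rat} := ('X *+ n + 1) ^+ n.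

Lemma coef_cube_poly n k : (cube_poly n)`_k = ('C(n, k) * n ^ k)%:R.
Proof.
rewrite /cube_poly exprD1n coef_sum.
under eq_bigr => i _ do rewrite exprMn_n !coefMn coefXn.
have [kn|nk] := ltnP k n.+1.
  rewrite (bigD1 (Ordinal kn))//= eqxx big1 => [|i ik].
    by rewrite addr0 -mulrnA -mulr_natr mul1r mulnC.
  by rewrite eq_sym (negbTE (ik : val i != k)) !mul0rn.
rewrite big1 => [|i _]; first by rewrite bin_small.
by rewrite gtn_eqF ?mul0rn// (leq_trans (ltn_ord i)).
Qed.

(** The ratio of consecutive coefficients is [n (n - k) / (k + 1)], and [n (n - k) >= n >= k + 1],
    with both equalities exactly when [k + 1 = n]. *)
Lemma leq_cube_coef n k : (k < n)%N ->
  ('C(n, k) * n ^ k <= 'C(n, k.+1) * n ^ k.+1 ?= iff (k.+1 == n))%N.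
Proof.
move=> kn; have e := mul_bin_left n k.
have n0 : (0 < n ^ k)%N by rewrite expn_gt0; lia.
have C0 : (0 < 'C(n, k))%N by rewrite bin_gt0 ltnW.
rewrite expnS mulnA; split.
  rewrite leq_pmul2r// -(@leq_pmul2l k.+1)// mulnA e.
  by rewrite mulnAC leq_pmul2r//; nia.
rewrite eqn_pmul2r// -(@eqn_pmul2l k.+1)// mulnA e mulnAC eqn_pmul2r//.
by apply/eqP/eqP; nia.
Qed.

(** An increment after multiplication by [X + 1] is a difference of coefficients of [cube_poly n]
    two indices apart; of these two steps the first is strict. At index 0 the increment is the
    linear coefficient. *)
Lemma increasing_coefs_cube_poly n : (0 < n)%N ->
  increasing_coefs n (('X + 1%:P) * cube_poly n).
Proof.
move=> n0; split.
  by rewrite mulrDl coefD coefXM coefCM /= add0r mul1r coef_cube_poly bin0 expn0.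
move=> k kn; rewrite mulrDl !coefD !coefXM !coefCM /= !mul1r [ltRHS]addrC ltrD2r.
case: k kn => [|k] kn /=.
  by rewrite coef_cube_poly ltr0n bin1 expn1 muln_gt0 n0.
rewrite !coef_cube_poly ltr_nat; apply: (@leq_trans ('C(n, k.+1) * n ^ k.+1)).
  by rewrite (ltn_leqif (leq_cube_coef n k _)); lia.
exact: leq_cube_coef.
Qed.

Definition rising (k : nat) : {poly rat} := \prod_(i < k) ('X + i.+1%:R%:P).

Lemma increasing_coefs_rising n r : (0 < n)%N ->
  increasing_coefs n (rising r.+1 * cube_poly n).
Proof.
move=> n0; elim: r => [|r IH].
  by rewrite /rising big_ord_recl big_ord0 mulr1; exact: increasing_coefs_cube_poly.
rewrite /rising big_ord_recr /= mulrAC mulrC.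
by apply: increasing_coefs_mul => //; rewrite ler1n.
Qed.

(** The coefficient is minus the increment of [p] from index [j - 2] to [j - 1], or minus the
    constant coefficient if [j = 1]. *)
Lemma increasing_coefs_neg n p j : increasing_coefs n p -> (0 < j <= n.+1)%N ->
  ('X * ('X - 1) * p)`_j < 0.
Proof.
move=> [p0 pI]; case: j => [//|[|j]] /= jn; rewrite -mulrA coefXM /= mulrBl mul1r coefB coefXM /=.
  by rewrite sub0r oppr_lt0.
by rewrite subr_lt0 pI.
Qed.

Lemma horner_rising k t : (rising k).[t%:R] = ((t + k) ^_ k)%:R.
Proof.
rewrite /rising; elim: k => [|k IH]; first by rewrite big_ord0 hornerC.
rewrite big_ord_recr /= hornerM IH addnS ffactSS natrM mulrC !hornerE.
by rewrite -natrD addnS.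
Qed.

(** The factors [t - 1, t, ..., t + k] form one falling factorial; for [t = 0] both sides vanish
    despite truncated subtraction. *)
Lemma horner_falling_rising k t :
  ('X * ('X - 1) * rising k).[t%:R] = ((t + k) ^_ k.+2)%:R.
Proof.
elim: k => [|k IH].
  rewrite /rising big_ord0 mulr1 addn0 ffactnS ffactn1 !hornerE.
  by case: t => [|t]; rewrite ?mul0r ?mul0n// natrM -natr1 addrK.
rewrite /rising big_ord_recr /= mulrA hornerM IH addnS ffactSS natrM mulrC !hornerE.
by rewrite -natrD addnS.
Qed.

(** Each index has its own archimedean threshold, and finitely many thresholds have a maximum. *)
Lemma eventually_neg (a b : nat -> rat) N :
  (forall j, (0 < j <= N)%N -> b j < 0) ->
  exists M : nat, forall m j, (M <= m)%N -> (0 < j <= N)%N -> a j + m%:R * b j < 0.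
Proof.
elim: N => [|N IH] b0; first by exists 0%N => m j; lia.
have [|M HM] := IH; first by move=> j hj; apply: b0; lia.
have bN : b N.+1 < 0 by apply: b0; lia.
exists (maxn M (Num.bound `|a N.+1 / b N.+1|)) => m j; rewrite geq_max => /andP[Mm hm] jN.
have [jN'|jN'] := leqP j N; first by apply: HM => //; lia.
have -> : j = N.+1 by lia.
rewrite -ltrBrDl sub0r -ltr_ndivrMr//.
apply: (le_lt_trans (ler_norm _)); rewrite mulNr normrN.
by apply: (lt_le_trans (archi_boundP (normr_ge0 _))); rewrite ler_nat.
Qed.

(** The two binomial coefficients of the iterated pyramid are put over the common denominator
    [(r + 3)!] and multiplied by the polynomial of the cube. *)
Definition ehrhart_poly (n r m : nat) : {poly rat} :=
  ((r.+3)`!%:R)^-1 *: (rising r.+3 * cube_poly n +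
    m.-1%:R *: ('X * ('X - 1) * (rising r.+1 * cube_poly n))).

Lemma horner_ehrhart_poly n r m t :
  (ehrhart_poly n r m).[t%:R] =
  (('C(t + r.+3, r.+3) + m.-1 * 'C(t + r.+1, r.+3)) * (t * n).+1 ^ n)%:R.
Proof.
rewrite /ehrhart_poly (mulrA _ (rising r.+1)) hornerZ hornerD hornerM hornerZ hornerM.
rewrite horner_rising horner_falling_rising.
have -> : (cube_poly n).[t%:R] = ((t * n).+1 ^ n)%:R.
  by rewrite /cube_poly horner_exp hornerD hornerMn hornerX hornerC natrX -natr1 natrM mulr_natr.
rewrite -!bin_ffact.
have : (r.+3)`!%:R != 0 :> rat by rewrite pnatr_eq0 -lt0n fact_gt0.
by move: (r.+3)`! => f f0; rewrite !natrM !natrD !natrM; field.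
Qed.

End Coefficients.

Theorem theorem3p8 (R : realType) (n r : nat) (n_gt0 : (0 < n)%N)
    (r_gt0 : (0 < r)%N) :
  (forall m : nat, (0 < m)%N ->
     integral_polytope (pyr_reeve_cube R m n r) /\
     has_dim (pyr_reeve_cube R m n r) (n + r + 3)) /\
  (exists M : nat, forall m : nat, (0 < m)%N -> (M <= m)%N ->
     exists2 p : {poly rat},
       is_ehrhart_poly (pyr_reeve_cube R m n r) p &
       forall j : nat, (1 <= j <= n + 1)%N -> p`_j < 0).
Proof.
split=> [m m0|].
  by split; [exact: integral_pyr_reeve_cube|exact: has_dim_pyr_reeve_cube].
pose Q := rising r.+1 * cube_poly n.
have [|M HM] := eventually_neg (fun j => (rising r.+3 * cube_poly n)`_j)
    (fun j => ('X * ('X - 1) * Q)`_j) n.+1.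
  by move=> j; apply: increasing_coefs_neg; exact: increasing_coefs_rising.
(* The multiplier in [ehrhart_poly] is [m.-1], so [m] must exceed the threshold [M] by one. *)
exists M.+1 => m m0 Mm; exists (ehrhart_poly n r m) => [t _|j].
  eexists; last exact: horner_ehrhart_poly.
  exact: ehrhart_count_cart_prod (ehrhart_count_iter_pyr R m r m0) (ehrhart_count_cube n) t.
rewrite addn1 => jn; rewrite coefZ coefD coefZ pmulr_rlt0.
  by apply: HM => //; lia.
by rewrite invr_gt0 ltr0n fact_gt0.
Qed.
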